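(* The following conditions are equivalent for a compact a-space $(X,\zeta)$. (1) There exist a set $I$ and a compact subset $K$ of $\mathbb{R}^I$ such that $(X,\zeta)$ and $(K,\operatorname{den})$ are isomorphic a-spaces. (2) There exists a unital Abelian $\ell$-group $(G,1)$ such that $(X,\zeta)$ and $(\operatorname{Max}G,\operatorname{den})$ are isomorphic a-spaces. (3) The map $\eta_X\colon X\to\operatorname{Max}\mathrm{C_a}(X)$ that sends $x\in X$ to the evaluation $\operatorname{ev}_x\colon\mathrm{C_a}(X)\to\mathbb{R}$, $\operatorname{ev}_x(a)=a(x)$, is an isomorphism of a-spaces.
   Context: $\mathbb{N}=\{0,1,2,\dots\}$ is ordered by divisibility ($0$ is the top element, $1$ the bottom); $\operatorname{lcm}$ of a possibly infinite subset of $\mathbb{N}$ is its supremum in this order (so it is $0$ if there is no positive common multiple). $\mathbb{N}$ carries the upper topology of the divisibility order: the sets $\{m\in\mathbb{N}\mid m \text{ divides } n\}$, $n\in\mathbb{N}$, form a subbasis for the closed sets. An a-space $(X,\zeta)$ is a topological space $X$ with a continuous function $\zeta\colon X\to\mathbb{N}$. An a-map $f\colon (X,\zeta)\to(X',\zeta')$ is a continuous map such that $\zeta'(f(x))$ divides $\zeta(x)$ for all $x\in X$; an isomorphism of a-spaces is a bijective a-map whose inverse is an a-map. A compact a-space is an a-space whose underlying space is compact (Hausdorffness not assumed). For $p/q\in\mathbb{Q}$ with $p\in\mathbb{Z}$, $q\geq 1$ coprime, $\operatorname{den}(p/q)=q$; for $r\in\mathbb{R}\setminus\mathbb{Q}$,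 $\operatorname{den}(r)=0$. For a set $I$ and $p=(p_i)_{i\in I}\in\mathbb{R}^I$, $\operatorname{den}(p)=\operatorname{lcm}\{\operatorname{den}(p_i)\mid i\in I\}$. $\mathbb{R}^I$ has the product topology, and $(K,\operatorname{den})$, for $K\subseteq\mathbb{R}^I$, is the a-space $K$ with the subspace topology and the restriction of $\operatorname{den}$. A unital Abelian $\ell$-group is an Abelian lattice-ordered group $G$ with a distinguished element $1$ such that for each $g\in G$ there is a positive integer $p$ with $g\le p\cdot 1$; a unital $\ell$-homomorphism is a group and lattice homomorphism preserving $1$. $\operatorname{Max}G\subseteq\mathbb{R}^G$ is the set of unital $\ell$-homomorphisms $G\to\mathbb{R}$, an a-space with the subspace topology and the restriction of $\operatorname{den}$, i.e. with denominator function $x\mapsto\operatorname{lcm}\{\operatorname{den}(x(g))\mid g\in G\}$. For a compact a-space $X$, $\mathrm{C_a}(X)$ is the unital Abelian $\ell$-group of a-maps $X\to(\mathbb{R},\operatorname{den})$ with pointwise operations and unit the constant function $1$. *)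

(* Defs.v *)
From HB Require Import structures.
From mathcomp Require Import all_boot all_order all_algebra finmap.
From mathcomp Require Import all_classical all_reals all_analysis.

Set Implicit Arguments.
Unset Strict Implicit.
Unset Printing Implicit Defensive.

Import Order.TTheory GRing.Theory Num.Theory.
Import numFieldNormedType.Exports.

Local Open Scope classical_set_scope.
Local Open Scope ring_scope.

(* The upper topology of the divisibility order on nat; natdvd is MathComp's
   alias of nat ordered by divisibility (nat itself carries the discrete
   topology in MathComp-Analysis). *)
HB.instance Definition _ := @isSubBaseTopological.Build natdvd nat setT
  (fun n => ~` [set m : natdvd | (m %| n)%N]).

Lemma open_natdvd (n : nat) : open (~` [set m : natdvd | (m %| n)%N]).
Proof.
exists [set (~` [set m : natdvd | (m %| n)%N])].
  move=> _ ->; exists [fset n]%fset; first by move=> i _; rewrite inE.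
  rewrite predeqE => m; split=> [|mn i /=]; first by apply; rewrite /= inE.
  by rewrite inE => /eqP ->.
by rewrite bigcup_set1.
Qed.

Lemma continuous_natdvdP (T : topologicalType) (f : T -> natdvd) :
  continuous f <-> forall n : nat, closed [set x | (f x %| n)%N].
Proof.
split=> [/continuousP fo n|fc].
  rewrite -[X in closed X]setCK; apply: open_closedC.
  exact: fo (open_natdvd n).
apply/continuousP => _ [D' sD' <-].
rewrite preimage_bigcup; apply: bigcup_open => B /sD' [F _ <-].
rewrite preimage_bigcap openE => x xF; apply: filter_bigI => n nF.
apply: open_nbhs_nbhs; split; last exact: xF.
by rewrite -preimage_setC; apply: closed_openC; exact: fc.
Qed.

(* The supremum for divisibility. The first argument of supremum is its value
   at set0, the bottom element 1; as a default for sets without a supremum it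
   is never used, see dvdn_lcm_set. *)
Definition lcm_set (S : set natdvd) : natdvd := supremum (1%N : natdvd) S.

Lemma dvdn_lcm_set (S : set natdvd) (n : nat) :
  (lcm_set S %| n)%N <-> forall m : natdvd, S m -> (m %| n)%N.
Proof.
have [k [uk lk]] : supremums S !=set0.
  have [[k [k0 kS]]|noS] := pselect (exists k : nat,
      (0 < k)%N /\ forall m : natdvd, S m -> (m %| k)%N).
    pose P k := (0 < k)%N && `[< forall m : natdvd, S m -> (m %| k)%N >].
    have exP : exists k, P k by exists k; rewrite /P k0; apply/asboolP.
    case: (ex_minnP exP) => q /andP[q0 /asboolP qS] qmin.
    exists q; split=> [m /qS //|b bS].
    suff : (q %| b)%N by [].
    apply: contraT; rewrite /dvdn -lt0n => r0.
    suff /qmin : P (b %% q)%N by rewrite leqNgt ltn_mod q0.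
    rewrite /P r0; apply/asboolP => m Sm.
    rewrite -(dvdn_addr _ (dvdn_mull (b %/ q)%N (qS _ Sm))) -divn_eq.
    exact: bS.
  exists 0%N; split=> [m _|b bS]; first exact: dvdn0.
  case: (posnP b) => [-> //|b0].
  by case: noS; exists b; split=> // m /bS.
have -> : lcm_set S = k.
  rewrite /lcm_set /supremum; case: ifPn => [/eqP S0|_].
    by apply/eqP; rewrite eq_sym -(dvdn1 k); apply: lk => m; rewrite S0.
  case: xgetP => [y -> Sy|/(_ k)]; last by case.
  exact: is_subset1_supremums Sy _.
split=> [kn m /uk mk|nS]; first exact: dvdn_trans mk kn.
exact: lk.
Qed.

(* p/q in lowest terms is sent to q, irrational numbers to 0. *)
Definition den1 {R : realType} (r : R) : natdvd :=
  xget (0%N : natdvd) [set (absz (denq q) : natdvd) | q in [set q | ratr q = r]].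

Lemma den1_ratr (R : realType) (q : rat) : den1 (ratr q : R) = absz (denq q).
Proof.
rewrite /den1; case: xgetP => [n -> /= [q' /(fmorph_inj (@ratr R)) -> //]|].
by move=> /(_ (absz (denq q))) []; exists q.
Qed.

Lemma den1_irrational (R : realType) (r : R) :
  (forall q : rat, ratr q != r) -> den1 r = 0%N.
Proof.
move=> rirr; rewrite /den1; case: xgetP => // n _ /= [q qr _].
by have := rirr q; rewrite qr eqxx.
Qed.

Lemma dvdn_den1 (R : realType) (r : R) (n : nat) : (0 < n)%N ->
  (den1 r %| n)%N <-> exists z : int, n%:R * r = z%:~R.
Proof.
move=> n0; have nr0 : n%:R != 0 :> R by rewrite pnatr_eq0 -lt0n.
split=> [rn|[z nrz]].
  have [[q qr]|nq] := pselect (exists q : rat, ratr q = r); last first.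
    move: rn; rewrite den1_irrational ?dvd0n ?gtn_eqF// => q.
    by apply/eqP => qr; apply: nq; exists q.
  move: rn; rewrite -qr den1_ratr => /dvdnP[k ->].
  exists (k%:Z * numq q).
  have d0 : (denq q)%:~R != 0 :> R by rewrite intr_eq0 denq_eq0.
  rewrite natrM rmorphM /= -[k%:~R]/(k%:R) -mulrA; congr (_ * _).
  rewrite -[(absz _)%:R]/((absz (denq q))%:~R) absz_denq /ratr mulrCA divff//.
  by rewrite mulr1.
have -> : r = ratr (z%:~R / n%:R).
  rewrite fmorph_div /= ratr_int ratr_nat -nrz mulrC mulrA.
  by rewrite mulVf// mul1r.
rewrite den1_ratr.
set q := z%:~R / n%:R.
have /eqP : q * n%:R = z%:~R by rewrite /q divfK// pnatr_eq0 -lt0n.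
have qn0 : (denq q)%:~R != 0 :> rat by rewrite intr_eq0 denq_eq0.
rewrite -{1}(divq_num_den q) mulrAC -(inj_eq (mulIf qn0)) divfK//.
rewrite -[n%:R]/(n%:~R) -!intrM eqr_int => /eqP E.
have /dvdzP : (denq q %| numq q * n)%Z by rewrite E dvdz_mull.
move/dvdzP; rewrite dvdzE abszM Gauss_dvdr//= coprime_sym.
exact: coprime_num_den.
Qed.

Lemma continuous_den1 (R : realType) : continuous (@den1 R).
Proof.
apply/continuous_natdvdP => -[|n].
  rewrite (_ : [set x | _] = setT); first exact: closedT.
  by rewrite predeqE => r; split => // _ /=; rewrite dvdn0.
rewrite -[X in closed X]setCK; apply: open_closedC.
have -> : ~` [set r : R | (den1 r %| n.+1)%N] =
    \bigcup_(z : int) ((fun r : R => n.+1%:R * r) @^-1` `]z%:~R, (z + 1)%:~R[).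
  rewrite predeqE => r; split=> [rn|[z _ /=]].
    exists (Num.floor (n.+1%:R * r)) => //=; rewrite in_itv /=.
    rewrite floorD1_gt andbT lt_neqAle floor_le andbT.
    apply/eqP => E; apply: rn => /=; apply/dvdn_den1 => //.
    by exists (Num.floor (n.+1%:R * r)).
  rewrite in_itv /= => /andP[zr rz] /dvdn_den1 => /(_ isT) [y E].
  move: zr rz; rewrite E !ltr_int ltzD1 => zy yz.
  by move: (lt_le_trans zy yz); rewrite ltxx.
apply: bigcup_open => z _; apply: open_comp; last exact: interval_open.
by move=> r _; exact: mulrl_continuous.
Qed.

(* The denominator on R^I, where {ptws I -> R} is the function type I -> R with
   the product topology. *)
Definition den {R : realType} {I : Type} (p : {ptws I -> R}) : natdvd :=
  lcm_set [set den1 (p i) | i in [set: I]].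

Lemma continuous_den (R : realType) (I : Type) : continuous (@den R I).
Proof.
apply/continuous_natdvdP => n.
have -> : [set p : {ptws I -> R} | (den p %| n)%N] =
    \bigcap_i ((fun p : {ptws I -> R} => p i) @^-1` [set r | (den1 r %| n)%N]).
  rewrite predeqE => p; split=> [pn i _ /=|pn /=].
    by move/dvdn_lcm_set: pn => /(_ (den1 (p i))); apply; exists i.
  by apply/dvdn_lcm_set => _ [i _ <-]; exact: pn.
apply: closed_bigI => i _.
have pc : continuous (fun p : {ptws I -> R} => p i).
  move=> p; have /cvg_sup/(_ i) : p --> p by exact: cvg_id.
  by move=> pi U Up; apply: pi; exact: initial_continuous Up.
apply: (proj1 (continuous_closedP _) pc).
by have /continuous_natdvdP := @continuous_den1 R.
Qed.

Structure aspace := ASpace {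
  aspace_sort :> topologicalType;
  aden : aspace_sort -> natdvd;
  continuous_aden : continuous aden }.

Structure compact_aspace := CompactASpace {
  compact_aspace_sort :> aspace;
  compact_aspaceT : compact [set: compact_aspace_sort] }.

Definition is_amap (X Y : aspace) (f : X -> Y) : Prop :=
  continuous f /\ forall x, (aden (f x) %| aden x)%N.

Definition is_aiso (X Y : aspace) (f : X -> Y) : Prop :=
  is_amap f /\ exists g : Y -> X, [/\ cancel f g, cancel g f & is_amap g].

Definition aisomorphic (X Y : aspace) : Prop := exists f : X -> Y, is_aiso f.

Definition real_aspace (R : realType) : aspace := ASpace (@continuous_den1 R).

Section sub_aspace.
Variables (R : realType) (I : Type) (K : set {ptws I -> R}).

Lemma continuous_den_val : continuous (fun p : set_type K => den (\val p)).
Proof.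
move=> p; apply: (@continuous_comp _ _ _ (@set_val _ K) (@den R I)).
  exact: initial_continuous.
exact: continuous_den.
Qed.

Definition sub_aspace : aspace := ASpace continuous_den_val.

End sub_aspace.

(* Abelian lattice-ordered groups. The lattice operations are fields of a mixin
   over zmodType, not an Order.Lattice structure: Hierarchy-Builder admits no
   join of Order.Lattice and GRing.Zmodule declared after Num.RealDomain. *)
HB.mixin Record isLGroup G of GRing.Zmodule G := {
  lle : rel G;
  lmeet : G -> G -> G;
  ljoin : G -> G -> G;
  lle_refl : reflexive lle;
  lle_anti : antisymmetric lle;
  lle_trans : transitive lle;
  lmeetP : forall g h k : G, lle g (lmeet h k) = lle g h && lle g k;
  ljoinP : forall g h k : G, lle (ljoin g h) k = lle g k && lle h k;
  lle_add2l : forall k g h : G, lle g h -> lle (k + g) (k + h) }.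

#[short(type="lgroupType")]
HB.structure Definition LGroup := { G of isLGroup G & GRing.Zmodule G }.

HB.mixin Record LGroup_isUnital G of LGroup G := {
  lunit : G;
  lunit_strong : forall g : G, exists2 p : nat, (0 < p)%N & lle g (lunit *+ p) }.

#[short(type="ulgroupType")]
HB.structure Definition UnitalLGroup := { G of LGroup_isUnital G & LGroup G }.

Definition is_ulhom (R : realType) (G : ulgroupType) (x : G -> R) : Prop :=
  [/\ {morph x : g h / g + h},
      {morph x : g h / lmeet g h >-> Num.min g h},
      {morph x : g h / ljoin g h >-> Num.max g h} &
      x lunit = 1].

Definition Max (R : realType) (G : ulgroupType) : set {ptws G -> R} :=
  [set x | is_ulhom x].
Arguments Max : clear implicits.

Record Ca (R : realType) (X : aspace) := MkCa {
  Ca_fun :> X -> R;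
  Ca_amap : is_amap (Y := real_aspace R) Ca_fun }.

Section Ca_lgroup.
Variables (R : realType) (X : aspace).
Implicit Types a b c : Ca R X.

Lemma Ca_eqP a b : a = b <-> a =1 b.
Proof.
split=> [->//|]; case: a b => [a pa] [b pb] /= /funext ab.
by move: ab pb => <- pb; congr MkCa; exact: Prop_irrelevance.
Qed.

Lemma Ca_continuous a : continuous (a : X -> R).
Proof. exact: (Ca_amap a).1. Qed.

Lemma Ca_den a x : (den1 (a x) %| aden x)%N.
Proof. exact: (Ca_amap a).2. Qed.

Lemma dvdn_den1D (r s : R) (n : nat) :
  (den1 r %| n)%N -> (den1 s %| n)%N -> (den1 (r + s) %| n)%N.
Proof.
case: n => [|n]; first by rewrite !dvdn0.
move=> /dvdn_den1-/(_ isT)[y ry] /dvdn_den1-/(_ isT)[z sz].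
by apply/dvdn_den1 => //; exists (y + z); rewrite mulrDr ry sz intrD.
Qed.

Lemma dvdn_den1N (r : R) (n : nat) : (den1 r %| n)%N -> (den1 (- r) %| n)%N.
Proof.
case: n => [|n]; first by rewrite !dvdn0.
move=> /dvdn_den1-/(_ isT)[y ry].
by apply/dvdn_den1 => //; exists (- y); rewrite mulrN ry intrN.
Qed.

Lemma dvdn_den1_int (z : int) (n : nat) : (den1 (z%:~R : R) %| n)%N.
Proof. by rewrite -ratr_int den1_ratr denq_int. Qed.

Lemma Ca_cst_subproof (z : int) :
  is_amap (Y := real_aspace R) (fun _ : X => z%:~R).
Proof. by split=> x; [exact: cvg_cst|exact: dvdn_den1_int]. Qed.

Definition Ca_cst (z : int) : Ca R X := MkCa (Ca_cst_subproof z).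

Lemma Ca_opp_subproof a : is_amap (Y := real_aspace R) (fun x => - a x).
Proof.
split=> x; last exact/dvdn_den1N/Ca_den.
by apply: (@cvgN _ R); exact: Ca_continuous.
Qed.

Definition Ca_opp a : Ca R X := MkCa (Ca_opp_subproof a).

Lemma Ca_add_subproof a b : is_amap (Y := real_aspace R) (fun x => a x + b x).
Proof.
split=> x; last by apply: dvdn_den1D; exact: Ca_den.
by apply: (@cvgD _ R); exact: Ca_continuous.
Qed.

Definition Ca_add a b : Ca R X := MkCa (Ca_add_subproof a b).

Lemma Ca_min_subproof a b :
  is_amap (Y := real_aspace R) (fun x => Num.min (a x) (b x)).
Proof.
split=> x; last by rewrite /= minEle; case: ifP => _; exact: Ca_den.
by apply: continuous_min; exact: Ca_continuous.
Qed.

Definition Ca_min a b : Ca R X := MkCa (Ca_min_subproof a b).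

Lemma Ca_max_subproof a b :
  is_amap (Y := real_aspace R) (fun x => Num.max (a x) (b x)).
Proof.
split=> x; last by rewrite /= maxEle; case: ifP => _; exact: Ca_den.
by apply: continuous_max; exact: Ca_continuous.
Qed.

Definition Ca_max a b : Ca R X := MkCa (Ca_max_subproof a b).

Definition Ca_le a b : bool := `[< forall x, a x <= b x >].

HB.instance Definition _ := gen_eqMixin (Ca R X).
HB.instance Definition _ := gen_choiceMixin (Ca R X).

Lemma Ca_addA : associative Ca_add.
Proof. by move=> a b c; apply/Ca_eqP => x /=; rewrite addrA. Qed.

Lemma Ca_addC : commutative Ca_add.
Proof. by move=> a b; apply/Ca_eqP => x /=; rewrite addrC. Qed.

Lemma Ca_add0 : left_id (Ca_cst 0) Ca_add.
Proof. by move=> a; apply/Ca_eqP => x /=; rewrite add0r. Qed.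

Lemma Ca_addN : left_inverse (Ca_cst 0) Ca_opp Ca_add.
Proof. by move=> a; apply/Ca_eqP => x /=; rewrite addNr. Qed.

HB.instance Definition _ :=
  GRing.isZmodule.Build (Ca R X) Ca_addA Ca_addC Ca_add0 Ca_addN.

Lemma Ca_le_refl : reflexive Ca_le.
Proof. by move=> a; apply/asboolP. Qed.

Lemma Ca_le_anti : antisymmetric Ca_le.
Proof.
move=> a b /andP[/asboolP ab /asboolP ba]; apply/Ca_eqP => x.
by apply/eqP; rewrite eq_le ab ba.
Qed.

Lemma Ca_le_trans : transitive Ca_le.
Proof.
move=> b a c /asboolP ab /asboolP bc; apply/asboolP => x.
exact: le_trans (ab x) (bc x).
Qed.

Lemma Ca_minP a b c : Ca_le a (Ca_min b c) = Ca_le a b && Ca_le a c.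
Proof.
apply/asboolP/andP => [abc|[/asboolP ab /asboolP ac] x /=].
  by split; apply/asboolP => x; have /= := abc x; rewrite le_min => /andP[].
by rewrite le_min ab ac.
Qed.

Lemma Ca_maxP a b c : Ca_le (Ca_max a b) c = Ca_le a c && Ca_le b c.
Proof.
apply/asboolP/andP => [abc|[/asboolP ac /asboolP bc] x /=].
  by split; apply/asboolP => x; have /= := abc x; rewrite ge_max => /andP[].
by rewrite ge_max ac bc.
Qed.

Lemma Ca_le_add2l c a b : Ca_le a b -> Ca_le (c + a) (c + b).
Proof. by move=> /asboolP ab; apply/asboolP => x /=; rewrite lerD2l. Qed.

HB.instance Definition _ := isLGroup.Build (Ca R X)
  Ca_le_refl Ca_le_anti Ca_le_trans Ca_minP Ca_maxP Ca_le_add2l.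

Lemma Ca_mulrnE a n x : (a *+ n) x = a x *+ n.
Proof. by elim: n => [|n IH] //=; rewrite !mulrS -IH. Qed.

End Ca_lgroup.

Section Ca_ulgroup.
Variables (R : realType) (X : compact_aspace).

Lemma Ca_strong_unit (a : Ca R X) :
  exists2 p : nat, (0 < p)%N & lle a (Ca_cst R X 1 *+ p).
Proof.
have : compact (range (a : X -> R)).
  apply: continuous_compact; last exact: compact_aspaceT.
  by apply: continuous_subspaceT; exact: Ca_continuous.
move=> /(@compact_bounded R R) /pinfty_ex_gt0[M M0 aM].
exists (Num.bound M).+1 => //; apply/asboolP => x.
rewrite Ca_mulrnE /=; apply: le_trans (ler_norm _) _.
apply: le_trans (aM (a x) _) _; first by exists x.
apply: le_trans (ltW (archi_boundP (ltW M0))) _.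
by rewrite ler_nat.
Qed.

HB.instance Definition _ := LGroup_isUnital.Build (Ca R X) Ca_strong_unit.

Lemma ev_in_Max (x : X) : (fun a : Ca R X => a x) \in Max R (Ca R X).
Proof. by rewrite inE; split. Qed.

Definition eta (x : X) : sub_aspace (Max R (Ca R X)) :=
  exist (fun y => y \in Max R (Ca R X)) (fun a : Ca R X => a x) (ev_in_Max x).

End Ca_ulgroup.

(* Main.v *)
Require Import Defs.
From mathcomp Require Import all_boot all_order all_algebra.
From mathcomp Require Import all_classical all_reals all_analysis.
From mathcomp Require Import lra.

(** Everything follows from one fact: if a compact a-space [X] is isomorphic to
    some subspace [K] of [R^I], then [eta] is an isomorphism. Indeed, if [X] is
    isomorphic to a space of unital homomorphisms [Max R G], by [eta] or
    otherwise, then [X] is isomorphic to a subspace of [R^G], and this subspace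
    is compact because [X] is.

    That [eta] is surjective holds for every compact a-space
    ([eta_surjective]). Given a unital homomorphism [phi] on the group of a-maps,
    the sets where [b <= 1], for [b >= 0] in the kernel of [phi], are closed and
    form the base of a proper filter: if [b > 1] held everywhere, then [b >= 1]
    in the group, whence [phi b >= 1]. Compactness yields a common point [x]. If
    [phi a] were smaller than [a x], a large multiple [n a] would leave room for
    an integer [m] with [n (phi a) <= m < n (a x) - 1], and the positive part of
    [n a - m] would be an element of the kernel exceeding 1 at [x]. Applying
    this to [a] and [- a] shows that [phi] is the evaluation at [x].

    That [eta] is an a-map is immediate. The isomorphism with [K] makes [eta]
    injective and its inverse an a-map ([eta_aiso_of_sub_aspace]): the
    coordinates of [X] in [R^I] are a-maps, so they are among the coordinates
    [a x] of [eta x], and they determine the point, the topology and the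
    denominators of [X]. *)

Import Order.TTheory GRing.Theory Num.Theory.
Import numFieldNormedType.Exports.

Set Implicit Arguments.
Unset Strict Implicit.
Unset Printing Implicit Defensive.

Local Open Scope classical_set_scope.
Local Open Scope ring_scope.

Lemma continuous_sub_aspace_coord (R : realType) (I : Type)
    (K : set {ptws I -> R}) (i : I) :
  continuous (fun p : sub_aspace K => (\val p : {ptws I -> R}) i).
Proof.
have pc : continuous (fun p : {ptws I -> R} => p i).
  move=> p; have /cvg_sup/(_ i) : p --> p by exact: cvg_id.
  by move=> pi U Up; apply: pi; exact: initial_continuous Up.
move=> p; apply: (@continuous_comp (sub_aspace K) {ptws I -> R} R
  (@set_val _ K) (fun p : {ptws I -> R} => p i)); last exact: pc.
exact: initial_continuous.
Qed.

Lemma continuous_to_sub_aspace (R : realType) (I : Type)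
    (K : set {ptws I -> R}) (T : topologicalType) (f : T -> sub_aspace K) :
  (forall i, continuous (fun t => (\val (f t) : {ptws I -> R}) i)) ->
  continuous f.
Proof.
move=> fc.
(* The topology of a subspace is, by definition, the initial one. *)
suff: continuous (f : T -> initial_topology (@set_val {ptws I -> R} K)) by [].
apply: continuous_comp_initial => t.
apply: (proj2 (@cvg_sup _ _ _ _ _ _)) => i; move: t.
suff: continuous ((set_val \o f) :
    T -> initial_topology (fun p : {ptws I -> R} => p i)) by [].
by apply: continuous_comp_initial; exact: fc.
Qed.

Lemma den1_coord (R : realType) (I : Type) (p : {ptws I -> R}) (i : I) :
  (den1 (p i) %| den p)%N.
Proof.
by apply: (proj1 (dvdn_lcm_set [set den1 (p i) | i in setT] _) (dvdnn _)); exists i.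
Qed.

Lemma den_dvd (R : realType) (I : Type) (p : {ptws I -> R}) (n : nat) :
  (forall i, den1 (p i) %| n)%N -> (den p %| n)%N.
Proof. by move=> pn; apply/dvdn_lcm_set => _ [i _ <-]. Qed.

Lemma compact_of_aisomorphic (R : realType) (X : compact_aspace) (I : Type)
    (K : set {ptws I -> R}) :
  aisomorphic X (sub_aspace K) -> compact K.
Proof.
move=> [f [[fc _] [g [_ gK _]]]].
have -> : K = (set_val \o f) @` setT.
  rewrite predeqE => p; split=> [Kp|[x _ <-]]; last exact: set_valP.
  by exists (g (SigSub (mem_set Kp))) => //=; rewrite gK.
apply: continuous_compact; last exact: compact_aspaceT.
apply: continuous_subspaceT => x.
by apply: continuous_comp; [exact: fc|exact: initial_continuous].
Qed.

Section unital_homomorphism.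
Variables (R : realType) (X : compact_aspace) (phi : Ca R X -> R).
Hypothesis phi_hom : is_ulhom phi.
Implicit Types a b c : Ca R X.

Let phiD a b : phi (a + b) = phi a + phi b.
Proof. by case: phi_hom => + _ _ _; apply. Qed.

Let phi0 : phi 0 = 0.
Proof. by apply: (addrI (phi 0)); rewrite -phiD !addr0. Qed.

Let phiN a : phi (- a) = - phi a.
Proof. by apply: (addrI (phi a)); rewrite -phiD !subrr phi0. Qed.

Let phi_mulrn a n : phi (a *+ n) = phi a *+ n.
Proof. by elim: n => [|n IH]; rewrite ?mulr0n// !mulrS phiD IH. Qed.

Let phi_max a b : phi (Ca_max a b) = Num.max (phi a) (phi b).
Proof. by case: phi_hom => _ _ + _; apply. Qed.

(** The constants are the integer multiples of the unit. *)
Let phi_cst (z : int) : phi (Ca_cst R X z) = z%:~R.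
Proof.
have phin n : phi (Ca_cst R X n%:Z) = n%:R.
  have -> : Ca_cst R X n%:Z = Ca_cst R X 1 *+ n.
    by apply/Ca_eqP => x; rewrite Ca_mulrnE.
  by rewrite phi_mulrn; case: phi_hom => _ _ _ ->.
case: z => [n|n]; first exact: phin.
rewrite NegzE; have -> : Ca_cst R X (- n.+1%:Z) = - Ca_cst R X n.+1%:Z.
  by apply/Ca_eqP => x /=; rewrite intrN.
by rewrite phiN phin intrN.
Qed.

Let phi_mono a b : (forall x, a x <= b x) -> phi a <= phi b.
Proof.
move=> ab; have <- : Ca_max a b = b.
  by apply/Ca_eqP => x /=; apply/max_idPr.
by rewrite phi_max le_max lexx.
Qed.

Let ker_pos : set (Ca R X) := [set b : Ca R X | (forall x, 0 <= b x) /\ phi b = 0].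

(** The threshold is 1 rather than 0 so that an element of [ker_pos] whose
    [small_set] is empty dominates the unit. *)
Let small_set (b : Ca R X) : set X := [set x | b x <= 1].

Let small_filter := filter_from ker_pos small_set.

Let small_filter_proper : ProperFilter small_filter.
Proof.
apply: filter_from_proper; first apply: filter_from_filter.
- by exists 0; split.
- move=> b c [b0 pb] [c0 pc]; exists (b + c).
    by split=> [x|]; rewrite ?phiD ?pb ?pc ?addr0//= addr_ge0.
  move=> x /= bcx; rewrite /small_set /=.
  by split; apply: le_trans bcx; rewrite ?lerDl ?lerDr.
- move=> b [b0 pb]; apply: contrapT => /set0P /negP; rewrite negbK => /eqP Z0.
  have /phi_mono : forall x, Ca_cst R X 1 x <= b x.
    move=> x /=; rewrite leNgt; apply/negP => /ltW bx.
    by have : small_set b x := bx; rewrite Z0.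
  by rewrite phi_cst pb ler10.
Qed.

(** A cluster point of [small_filter] lies in every [small_set], as these are
    closed. As the bound 1 also holds for all multiples of [b], such a point is
    in fact a common zero of the nonnegative elements of the kernel. *)
Lemma ulhom_common_point :
  exists x : X, forall b : Ca R X, (forall y, 0 <= b y) -> phi b = 0 -> b x <= 1.
Proof.
have [|x [_ clx]] := @compact_aspaceT X small_filter small_filter_proper.
  by exists 0 => //; split.
exists x => b b0 pb.
have : closed (small_set b).
  apply: (@preimage_closed _ _ b [set r | r <= 1]); last exact: closed_le.
  by move=> y _; exact: Ca_continuous.
apply => U Ux; apply: clx Ux.
by exists b.
Qed.

(** If [phi a < a x], some [n a - m] with integer [m] has a nonpositive value
    under [phi] and a value above 1 at [x]; its positive part contradicts the
    choice of [x]. *)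
Let ulhom_ge x a :
  (forall b : Ca R X, (forall y, 0 <= b y) -> phi b = 0 -> b x <= 1) ->
  a x <= phi a.
Proof.
move=> xP; rewrite leNgt; apply/negP => pax.
(* The gap between the two values of [n a] exceeds 2, so that rounding
   [phi (n a)] up to an integer [m] leaves more than 1 below [n a x]. *)
have d0 : 0 < a x - phi a by rewrite subr_gt0.
pose n := Num.bound (2 / (a x - phi a)).
have n2 : 2 < (a x - phi a) *+ n.
  rewrite -[ltRHS]mulr_natl -ltr_pdivrMr//.
  by apply: archi_boundP; rewrite divr_ge0// ltW.
pose m := Num.ceil (phi a *+ n).
pose b := Ca_max (a *+ n - Ca_cst R X m) 0.
have pb : phi b = 0.
  rewrite phi_max phi0 phiD phiN phi_mulrn phi_cst.
  by apply/max_idPr; rewrite subr_le0 ceil_ge.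
have b0 y : 0 <= b y by rewrite /b /= le_max lexx orbT.
have := xP b b0 pb; rewrite /b /= ge_max => /andP[+ _].
rewrite Ca_mulrnE leNgt => /negP; apply.
have := ceilB1_lt (phi a *+ n); rewrite intrB -/m.
move: n2; rewrite mulrnBl; set u := a x *+ n; set v := phi a *+ n.
lra.
Qed.

Lemma ulhom_is_ev : exists x : X, forall a : Ca R X, phi a = a x.
Proof.
have [x xP] := ulhom_common_point.
exists x => a; apply/eqP; rewrite eq_le ulhom_ge// andbT.
by rewrite -lerN2 -phiN; exact: (ulhom_ge (- a) xP).
Qed.

End unital_homomorphism.

Lemma eta_surjective (R : realType) (X : compact_aspace)
    (y : sub_aspace (Max R (Ca R X))) : exists x, eta R x = y.
Proof.
have [x xP] := ulhom_is_ev (set_valP y).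
by exists x; apply: val_inj; apply/funext => a; exact/esym/xP.
Qed.

Lemma eta_amap (R : realType) (X : compact_aspace) : is_amap (@eta R X).
Proof.
split; first by apply: continuous_to_sub_aspace => a; exact: Ca_continuous.
by move=> x; apply: den_dvd => a; exact: Ca_den.
Qed.

(** Composing an isomorphism [f] onto [K] with the coordinates gives a-maps
    [coord i] on [X]. Hence the point [f x], and with it [x], can be read off
    from the values of [eta x] at the [coord i]; this reading is continuous, and
    it does not increase denominators because those of [f x] are least common
    multiples of the denominators of its coordinates. *)
Lemma eta_aiso_of_sub_aspace (R : realType) (X : compact_aspace) (I : Type)
    (K : set {ptws I -> R}) :
  aisomorphic X (sub_aspace K) -> is_aiso (@eta R X).
Proof.
move=> [f [[fc fden] [f' [fK f'K [f'c f'den]]]]].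
have coord_amap i :
    is_amap (Y := real_aspace R) (fun x : X => (\val (f x) : {ptws I -> R}) i).
  split=> x; last exact: dvdn_trans (den1_coord _ _) (fden x).
  apply: (@continuous_comp _ _ _ f (fun p => (\val p : {ptws I -> R}) i)).
    exact: fc.
  exact: continuous_sub_aspace_coord.
pose coord i : Ca R X := MkCa (coord_amap i).
have [g etaK] := choice (@eta_surjective R X).
have coordg i y : (\val (f (g y)) : {ptws I -> R}) i =
    (\val y : {ptws Ca R X -> R}) (coord i).
  by rewrite -[in RHS](etaK y).
split; first exact: eta_amap.
exists g; split => //; last split.
- move=> x; apply: (can_inj fK); apply: val_inj; apply/funext => i.
  by rewrite coordg.
(* The topology of [X] is initial for the maps [coord i]. *)
- have -> : g = f' \o (f \o g) by apply/funext => y /=; rewrite fK.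
  move=> y; apply: continuous_comp; last exact: f'c.
  apply: continuous_to_sub_aspace => i.
  under eq_fun do rewrite coordg.
  exact: continuous_sub_aspace_coord.
- move=> y; rewrite -[g y]fK; apply: dvdn_trans (f'den _) _.
  by apply: den_dvd => i; rewrite coordg; exact: den1_coord.
Qed.

Theorem theorem3p2 (R : realType) (X : compact_aspace) :
  [<-> exists (I : Type) (K : set {ptws I -> R}),
         compact K /\ aisomorphic X (sub_aspace K);
       exists G : ulgroupType, aisomorphic X (sub_aspace (Max R G));
       is_aiso (@eta R X)].
Proof.
tfae.
- move=> [I [K [_ XK]]]; exists (Ca R X), (@eta R X).
  exact: eta_aiso_of_sub_aspace XK.
- by move=> [G XG]; exact: eta_aiso_of_sub_aspace XG.
- move=> eta_iso; have XM : aisomorphic X (sub_aspace (Max R (Ca R X))).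
    by exists (@eta R X).
  by exists (Ca R X), (Max R (Ca R X)); split => //; exact: compact_of_aisomorphic XM.
Qed.
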